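(* The following conjecture (stated by Stembridge) is false: ''for every finite simple graph $G$, $[Z^o_G]$ is a polynomial in $\mathbf{Z}[q]$.'' That is, there exists a finite simple graph $G$ for which there is no polynomial $f\in\mathbf{Z}[q]$ with $\#Z^o_G(\mathbf{F}_q)=f(q)$ for all prime powers $q$.
   Context: A simple graph has no loops and no multiple edges. For a finite simple graph $G$ with vertices $v_1,\dots,v_n$, $Z^o_G$ is the scheme over $\mathbf{Z}$ of all nondegenerate (invertible) symmetric $n\times n$ matrices $M$ such that $M_{ij}=0$ whenever $i\ne j$ and there is no edge from $v_i$ to $v_j$. $[Z^o_G]$ is the function $q\mapsto\#Z^o_G(\mathbf{F}_q)$ on prime powers $q$. *)

(* Defs.v *)
From mathcomp Require Import all_boot all_order all_algebra.

Set Implicit Arguments.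
Unset Strict Implicit.
Unset Printing Implicit Defensive.

Import GRing.Theory.
Local Open Scope ring_scope.

Record sgraph (n : nat) := SGraph {
  edge : rel 'I_n;
  edge_sym : symmetric edge;
  edge_irrefl : irreflexive edge
}.

(* The scheme Z^o_G over the integers, through its functor of points:
   Zo_pts G R is the set Z^o_G(R), as a predicate on n x n matrices.
   Diagonal entries are unconstrained. *)
Definition Zo_pts (n : nat) (G : sgraph n) (R : comUnitRingType) :
    pred 'M[R]_n :=
  fun M => [&& M \in unitmx, M^T == M
    & [forall i, forall j, (i != j) && ~~ edge G i j ==> (M i j == 0)]].

Definition Zo_count (n : nat) (G : sgraph n) (F : finFieldType) : nat :=
  #|[set M : 'M[F]_n | Zo_pts G M]|.

(* Prime powers q are exactly the cardinals of finite fields, and F_q is unique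
   up to isomorphism, so "for all prime powers q" is a quantification over all
   finite fields F, with q = #|F|. *)
Definition Zo_polynomial (n : nat) (G : sgraph n) : Prop :=
  exists f : {poly int},
    forall F : finFieldType, (Zo_count G F)%:Z = f.[#|F|%:Z].

(* Main.v *)
Require Import Defs.
From mathcomp Require Import all_boot all_order all_algebra.
From mathcomp Require Import ring zify.
From Stdlib Require Import Classical.

(** Suppose every count is polynomial. For a split graph (an independent set on
    the left, a clique on the right) a left vertex is simplicial, so imposing
    the vanishing of its diagonal entry only subtracts another such count;
    inclusion-exclusion also lets one impose nonzero off-diagonal entries. One
    thus counts the nondegenerate matrices [[0, Y, W], [Y^T, *, *],
    [W^T, *, *]] with Y of exact support S and W supported on its last n - s
    columns. The number of completions of Y depends only on its rank, is zero
    when this rank is below s and nonzero when it is s, so a triangular system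
    shows that the number of matrices of exact support S and given rank is a
    rational function of q. For S the complement of the incidence relation of
    the Fano plane, a matrix of rank at most 3 exists in characteristic 2 and in
    no other: a rational function would vanish at all odd primes but not at 2. *)

Set Implicit Arguments.
Unset Strict Implicit.
Unset Printing Implicit Defensive.

Import GRing.Theory Num.Theory.
Local Open Scope ring_scope.

(** * Functions of a finite field that are rational in its cardinal *)

(* The denominator is required not to vanish at any prime power. *)
Definition rational_in_card (phi : finFieldType -> int) : Prop :=
  exists d f : {poly int}, forall F : finFieldType,
    d.[#|F|%:Z] != 0 /\ phi F * d.[#|F|%:Z] = f.[#|F|%:Z].

Lemma rational_ext phi psi :
  phi =1 psi -> rational_in_card phi -> rational_in_card psi.
Proof.
by move=> E [d [f H]]; exists d, f => F; rewrite -E; apply: H.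
Qed.

Lemma rational_poly (f : {poly int}) :
  rational_in_card (fun F => f.[#|F|%:Z]).
Proof. by exists 1, f => F; rewrite hornerC oner_eq0 mulr1. Qed.

Lemma rational_cst (c : int) : rational_in_card (fun=> c).
Proof.
by apply: rational_ext (rational_poly c%:P) => F; rewrite hornerC.
Qed.

Lemma rational_card : rational_in_card (fun F => #|F|%:Z).
Proof. by apply: rational_ext (rational_poly 'X) => F; rewrite hornerX. Qed.

Lemma rationalD phi psi : rational_in_card phi -> rational_in_card psi ->
  rational_in_card (fun F => phi F + psi F).
Proof.
move=> [d [f H]] [e [g K]]; exists (d * e), (f * e + g * d) => F.
have [H1 H2] := H F; have [K1 K2] := K F.
by rewrite !(hornerD, hornerM) -H2 -K2 mulf_neq0 //; split=> //; ring.
Qed.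

Lemma rationalM phi psi : rational_in_card phi -> rational_in_card psi ->
  rational_in_card (fun F => phi F * psi F).
Proof.
move=> [d [f H]] [e [g K]]; exists (d * e), (f * g) => F.
have [H1 H2] := H F; have [K1 K2] := K F.
by rewrite !(hornerD, hornerM) -H2 -K2 mulf_neq0 //; split=> //; ring.
Qed.

Lemma rationalB phi psi : rational_in_card phi -> rational_in_card psi ->
  rational_in_card (fun F => phi F - psi F).
Proof.
move=> H K; have := rationalD H (rationalM (rational_cst (-1)) K).
by apply: rational_ext => F; rewrite mulN1r.
Qed.

Lemma rational_sum (I : Type) (s : seq I) (P : pred I)
    (phi : I -> finFieldType -> int) :
  (forall i, P i -> rational_in_card (phi i)) ->
  rational_in_card (fun F => \sum_(i <- s | P i) phi i F).
Proof.
move=> H; elim: s => [|i s IH].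
  by apply: rational_ext (rational_cst 0) => F; rewrite big_nil.
case Pi: (P i).
  by apply: rational_ext (rationalD (H i Pi) IH) => F; rewrite big_cons Pi.
by apply: rational_ext IH => F; rewrite big_cons Pi.
Qed.

Lemma rational_prod (I : Type) (s : seq I)
    (phi : I -> finFieldType -> int) :
  (forall i, rational_in_card (phi i)) ->
  rational_in_card (fun F => \prod_(i <- s) phi i F).
Proof.
move=> H; elim: s => [|i s IH].
  by apply: rational_ext (rational_cst 1) => F; rewrite big_nil.
by apply: rational_ext (rationalM (H i) IH) => F; rewrite big_cons.
Qed.

(** Since [psi] never vanishes, neither does its numerator at a prime power, so this numerator can
    enter the denominator of the quotient. *)
Lemma rational_cancelM phi psi : (forall F, psi F != 0) ->
  rational_in_card psi -> rational_in_card (fun F => phi F * psi F) ->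
  rational_in_card phi.
Proof.
move=> psi0 [d [f H]] [e [g K]]; exists (f * e), (g * d) => F.
have [H1 H2] := H F; have [K1 K2] := K F.
by rewrite !(hornerD, hornerM) -H2 -K2 !mulf_neq0 //; split=> //; ring.
Qed.

Lemma odd_primes_uniq k :
  exists s : seq nat, [/\ size s = k, uniq s & all (fun p => prime p && odd p) s].
Proof.
elim: k => [|k [s [ss us as_]]]; first by exists [::].
have [p lt_p pr_p] := prime_above (maxn 2 (\max_(i <- s) i)).
move: lt_p; rewrite gtn_max => /andP[p2 lt_p].
exists (p :: s); rewrite /= ss us pr_p as_ !andbT; split => //.
  apply/negP => ps; move: lt_p; rewrite ltnNge.
  by rewrite (leq_bigmax_seq _ ps).
by case/even_prime: pr_p p2 => [->|].
Qed.

(** The numerator has more roots than its degree allows, so it is zero, while the denominator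
    vanishes at no prime power. Values at odd primes thus determine those in characteristic 2. *)
Lemma rational_eq0_odd_primes phi : rational_in_card phi ->
  (forall p, prime p -> odd p -> phi 'F_p = 0) -> forall F, phi F = 0.
Proof.
move=> [d [f H]] phi0.
have f0 : f = 0.
  apply/eqP/negPn/negP => fn0.
  have [s [ss us /allP as_]] := odd_primes_uniq (size f).
  have := @max_poly_roots _ f [seq p%:Z | p <- s] fn0.
  rewrite map_inj_uniq ?us; last by move=> a b [].
  rewrite size_map ss ltnn => /(_ _ isT); move=> K; suff: false by [].
  apply: K; apply/allP => _ /mapP[p /as_ /andP[pr_p odd_p] ->].
  have [_] := H 'F_p; rewrite phi0 // mul0r card_Fp // => fp.
  by rewrite /root -fp.
move=> F; have [dn0] := H F; rewrite f0 horner0 => /eqP.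
by rewrite mulf_eq0 (negPf dn0) orbF => /eqP.
Qed.

(** * Counting matrices with entrywise conditions *)

Lemma card_in_cancel (A B : finType) (D : {set A}) (E : {set B}) f g :
  {in D, forall x, f x \in E} -> {in E, forall y, g y \in D} ->
  {in D, cancel f g} -> {in E, cancel g f} -> #|D| = #|E|.
Proof.
move=> fD gE fK gK; rewrite -(card_in_imset (can_in_inj fK)).
congr #|pred_of_set _|; apply/setP => y; apply/imsetP/idP => [[x xD ->]|yE].
  exact: fD.
by exists (g y); rewrite ?gE ?gK.
Qed.

Lemma card_mx_entries (F : finFieldType) m n (P : 'I_m -> 'I_n -> pred F) :
  #|[set X : 'M[F]_(m, n) | [forall i, forall j, P i j (X i j)]]| =
  (\prod_(u : 'I_m * 'I_n) #|P u.1 u.2|)%N.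
Proof.
rewrite (@card_in_cancel _ _ _
  [set f | f \in family (fun u : 'I_m * 'I_n => P u.1 u.2)]
  (fun X : 'M[F]_(m, n) => [ffun u => X u.1 u.2])
  (fun f : {ffun 'I_m * 'I_n -> F} => \matrix_(i, j) f (i, j))).
- by rewrite cardsE card_family foldrE big_map enumT.
- move=> X; rewrite !inE => /forallP PX; apply/familyP => -[i j].
  by rewrite ffunE; apply: (forallP (PX i)).
- move=> f; rewrite !inE => /familyP Pf; apply/forallP => i; apply/forallP => j.
  by rewrite mxE; apply: (Pf (i, j)).
- by move=> X _; apply/matrixP => i j; rewrite mxE ffunE.
- by move=> f _; apply/ffunP => -[i j]; rewrite ffunE mxE.
Qed.

Definition exact_support (F : finFieldType) m n (S : {set 'I_m * 'I_n}) :
    pred 'M[F]_(m, n) :=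
  fun Y => [forall i, forall j, (Y i j != 0) == ((i, j) \in S)].

Lemma exact_supportP (F : finFieldType) m n (S : {set 'I_m * 'I_n})
    (Y : 'M[F]_(m, n)) :
  reflect (forall i j, (Y i j != 0) = ((i, j) \in S)) (exact_support S Y).
Proof.
apply: (iffP forallP) => [H i j|H i]; last by apply/forallP => j; rewrite H.
by have /forallP/(_ j)/eqP := H i.
Qed.

Lemma rational_card_exact_support m n (S : {set 'I_m * 'I_n}) :
  rational_in_card (fun F => #|[set Y : 'M[F]_(m, n) | exact_support S Y]|%:Z).
Proof.
have H (u : 'I_m * 'I_n) : rational_in_card (fun F : finFieldType =>
    #|[pred x : F | (x != 0) == (u \in S)]|%:Z).
  case: (u \in S).
    apply: rational_ext (rationalB rational_card (rational_cst 1)) => F.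
    have -> : #|[pred x : F | (x != 0) == true]| = #|predC1 (0 : F)|.
      by apply: eq_card => x; rewrite !inE eqb_id.
    have : (0 < #|F|)%N by apply/card_gt0P; exists 0.
    by rewrite cardC1; case: #|F| => // k _; lia.
  apply: rational_ext (rational_cst 1) => F.
  rewrite -[1]/(1%N : int) -(card1 (0 : F)); congr Posz.
  by apply: eq_card => x; rewrite !inE eqbF_neg negbK.
apply: rational_ext (rational_prod (index_enum _) H) => F.
by rewrite (card_mx_entries (fun i j x => (x != 0) == ((i, j) \in S)))
  (big_morph Posz PoszM (erefl 1)); apply: eq_bigr => -[i j].
Qed.

Lemma exact_support_card_neq0 (F : finFieldType) m n (S : {set 'I_m * 'I_n}) :
  #|[set Y : 'M[F]_(m, n) | exact_support S Y]|%:Z != 0.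
Proof.
suff: (0 < #|[set Y : 'M[F]_(m, n) | exact_support S Y]|)%N by case: #|_|.
apply/card_gt0P; exists (\matrix_(i, j) ((i, j) \in S)%:R); rewrite inE.
by apply/exact_supportP => i j; rewrite mxE; case: (_ \in S); rewrite ?oner_eq0 ?eqxx.
Qed.

(** * Split graphs and their nondegenerate matrices *)

Definition split_edge n r (S : {set 'I_n * 'I_r}) : rel 'I_(n + r) :=
  fun u v => match split u, split v with
  | inl _, inl _ => false
  | inl i, inr j | inr j, inl i => (i, j) \in S
  | inr j, inr k => j != k
  end.

Lemma split_edge_sym n r (S : {set 'I_n * 'I_r}) : symmetric (split_edge S).
Proof.
by move=> u v; rewrite /split_edge; case: split => a; case: split => b //; rewrite eq_sym.
Qed.

Lemma split_edge_irrefl n r (S : {set 'I_n * 'I_r}) : irreflexive (split_edge S).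
Proof. by move=> u; rewrite /split_edge; case: split => a //; rewrite eqxx. Qed.

(** The edges between left and right form an arbitrary relation [S], so deleting some of them stays
    within this family. *)
Definition split_graph n r (S : {set 'I_n * 'I_r}) :=
  SGraph (split_edge_sym S) (split_edge_irrefl S).

(** These are the intermediate sets of the inclusion-exclusion: [Z] collects the left diagonal
    entries made to vanish, [N] the entries of the upper right block made nonzero. The graph itself
    is the case where both are empty. *)
Definition split_pts (F : finFieldType) n r (S : {set 'I_n * 'I_r})
    (Z : {set 'I_n}) (N : {set 'I_n * 'I_r}) : {set 'M[F]_(n + r)} :=
  [set M | [&& M \in unitmx, M^T == M,
    [forall i, forall j, (i != j) || (i \in Z) ==> (ulsubmx M i j == 0)],
    [forall i, forall j, ((i, j) \notin S) ==> (ursubmx M i j == 0)] &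
    [forall i, forall j, ((i, j) \in N) ==> (ursubmx M i j != 0)]]].

Lemma split_ptsP (F : finFieldType) n r (S : {set 'I_n * 'I_r})
    (Z : {set 'I_n}) (N : {set 'I_n * 'I_r}) (M : 'M[F]_(n + r)) :
  reflect [/\ M \in unitmx, M^T = M,
    forall i j, (i != j) || (i \in Z) -> ulsubmx M i j = 0,
    forall i j, (i, j) \notin S -> ursubmx M i j = 0 &
    forall i j, (i, j) \in N -> ursubmx M i j != 0]
  (M \in split_pts F S Z N).
Proof.
rewrite inE; apply: (iffP and5P) => -[uM /eqP sM H1 H2 H3]; split=> //.
- by move=> i j; have /forallP/(_ j)/implyP H := forallP H1 i; move/H/eqP.
- by move=> i j; have /forallP/(_ j)/implyP H := forallP H2 i; move/H/eqP.
- by move=> i j; have /forallP/(_ j)/implyP := forallP H3 i; apply.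
- by apply/forallP => i; apply/forallP => j; apply/implyP => /H1 ->.
- by apply/forallP => i; apply/forallP => j; apply/implyP => /H2 ->.
- by apply/forallP => i; apply/forallP => j; apply/implyP => /H3.
Qed.

Lemma Zo_count_split (F : finFieldType) n r (S : {set 'I_n * 'I_r}) :
  Zo_count (split_graph S) F = #|split_pts F S set0 set0|.
Proof.
apply: eq_card => M; rewrite inE; apply/idP/split_ptsP.
  case/and3P=> uM /eqP sM /forallP H; split=> // i j.
  - rewrite inE orbF => ij; apply/eqP; rewrite !mxE.
    have /forallP/(_ (lshift r j))/implyP := H (lshift r i); apply.
    by rewrite /= /split_edge !(unsplitK (inl _)) andbT (inj_eq (@lshift_inj _ _)).
  - move=> ijS; apply/eqP; rewrite !mxE.
    have /forallP/(_ (rshift n j))/implyP := H (lshift r i); apply.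
    by rewrite /= /split_edge (unsplitK (inl _)) (unsplitK (inr _)) ijS eq_lrshift.
  - by rewrite inE.
case=> uM sM H1 H2 _; rewrite /Zo_pts uM sM eqxx /=.
apply/forallP => u; apply/forallP => v; apply/implyP.
rewrite /split_edge -[u]splitK -[v]splitK !unsplitK.
case: (split u) (split v) => [i|j] [k|l] /andP[uv] /=.
- move=> _; have := H1 i k; rewrite !mxE => -> //.
  by rewrite -(inj_eq (@lshift_inj n r)) uv.
- by move/H2; rewrite !mxE => ->.
- by rewrite -sM mxE => /H2; rewrite !mxE => ->.
- by rewrite negbK => /eqP jl; rewrite jl eqxx in uv.
Qed.

(** * Clearing the row of a simplicial vertex by congruence *)

Definition shear (F : fieldType) n r (z : 'I_n) (x : 'rV[F]_r) : 'M[F]_(n + r) :=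
  block_mx 1%:M (delta_mx z 0 *m x) 0 1%:M.

Lemma shear_unit (F : fieldType) n r (z : 'I_n) (x : 'rV[F]_r) : shear z x \in unitmx.
Proof. by rewrite unitmxE det_ublock !det1 mulr1 unitr1. Qed.

Lemma shearK (F : fieldType) n r (z : 'I_n) (x : 'rV[F]_r) :
  shear z x *m shear z (- x) = 1%:M.
Proof.
rewrite /shear mulmx_block !mulmx1 !mulmx0 !mul0mx !mul1mx !addr0 !add0r.
by rewrite mulmxN addrC subrr -scalar_mx_block.
Qed.

Definition shear_congr (F : fieldType) n r (z : 'I_n) (x : 'rV[F]_r)
    (M : 'M[F]_(n + r)) := (shear z x)^T *m M *m shear z x.

Lemma shear_congrK (F : fieldType) n r (z : 'I_n) (x : 'rV[F]_r) :
  cancel (shear_congr z x) (shear_congr z (- x)).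
Proof.
move=> M; rewrite /shear_congr !mulmxA -trmx_mul shearK trmx1 mul1mx.
by rewrite -mulmxA shearK mulmx1.
Qed.

Lemma shear_congr_unit (F : fieldType) n r (z : 'I_n)
    (x : 'rV[F]_r) (M : 'M[F]_(n + r)) :
  (shear_congr z x M \in unitmx) = (M \in unitmx).
Proof. by rewrite !unitmx_mul unitmx_tr shear_unit andbT. Qed.

Lemma shear_congr_sym (F : fieldType) n r (z : 'I_n)
    (x : 'rV[F]_r) (M : 'M[F]_(n + r)) :
  M^T = M -> (shear_congr z x M)^T = shear_congr z x M.
Proof. by move=> sM; rewrite /shear_congr !trmx_mul trmxK sM mulmxA. Qed.

Lemma ulsubmx_shear_congr (F : fieldType) n r (z : 'I_n)
    (x : 'rV[F]_r) (M : 'M[F]_(n + r)) :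
  ulsubmx (shear_congr z x M) = ulsubmx M.
Proof.
rewrite /shear_congr -[M]submxK /shear tr_block_mx !mulmx_block !trmx1 !trmx0.
by rewrite !block_mxKul !mul0mx !mulmx0 !mul1mx !mulmx1 !addr0.
Qed.

Lemma ursubmx_shear_congr (F : fieldType) n r (z : 'I_n)
    (x : 'rV[F]_r) (M : 'M[F]_(n + r)) :
  (forall i j, i != j -> ulsubmx M i j = 0) -> forall i j,
  ursubmx (shear_congr z x M) i j =
  ursubmx M i j + (i == z)%:R * ulsubmx M z z * x 0 j.
Proof.
move=> dM i j.
have -> : ursubmx (shear_congr z x M) = ulsubmx M *m (delta_mx z 0 *m x) + ursubmx M.
  rewrite /shear_congr -[M in LHS]submxK /shear tr_block_mx !mulmx_block.
  by rewrite !trmx1 !trmx0 !block_mxKur !mul0mx !mul1mx !mulmx1 !addr0.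
rewrite mulmxA -colE mxE addrC; congr (_ + _).
rewrite mxE big_ord1 mxE; case: eqP => [->|/eqP ne]; first by rewrite mul1r.
by rewrite (dM i z) // !mul0r.
Qed.

Lemma unitmx_row_neq0 (F : fieldType) n (M : 'M[F]_n) i :
  M \in unitmx -> row i M != 0.
Proof.
move=> uM; apply/eqP => M0.
have : row i (M *m invmx M) = 0 by rewrite row_mul M0 mul0mx.
rewrite mulmxV // row1 => /matrixP/(_ 0 i); rewrite !mxE !eqxx => /eqP.
by rewrite oner_eq0.
Qed.

Definition clear_row n r (S : {set 'I_n * 'I_r}) (z : 'I_n) :=
  [set u in S | u.1 != z].

(** Without edges at [z], the diagonal entry is the only one that can be nonzero in row [z], and an
    invertible matrix has no zero row. *)
Lemma split_pts_diag_neq0 (F : finFieldType) n r (S : {set 'I_n * 'I_r})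
    (Z : {set 'I_n}) (N : {set 'I_n * 'I_r}) z (M : 'M[F]_(n + r)) :
  M \in split_pts F (clear_row S z) Z N -> ulsubmx M z z != 0.
Proof.
case/split_ptsP=> uM _ H1 H2 _.
apply: contra (unitmx_row_neq0 (lshift r z) uM) => /eqP Mz.
apply/eqP/rowP => k; rewrite !mxE -[k]splitK; case: (split k) => j /=.
  case: (eqVneq z j) => [<-|zj]; first by move: Mz; rewrite !mxE.
  by have := H1 z j; rewrite zj => /(_ isT); rewrite !mxE.
by have := H2 z j; rewrite !inE eqxx andbF !mxE => ->.
Qed.

Definition row_supp (F : finFieldType) n r (S : {set 'I_n * 'I_r}) (z : 'I_n)
    : {set 'rV[F]_r} :=
  [set x : 'rV[F]_r | [forall i : 'I_1, forall j, ((z, j) \notin S) ==> (x i j == 0)]].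

Lemma row_suppP (F : finFieldType) n r (S : {set 'I_n * 'I_r}) z (x : 'rV[F]_r) :
  reflect (forall j, (z, j) \notin S -> x 0 j = 0) (x \in row_supp F S z).
Proof.
rewrite inE; apply: (iffP forallP) => [H j|H i].
  by have /forallP/(_ j)/implyP K := H 0 => /K/eqP.
by apply/forallP => j; apply/implyP => /H; rewrite [i]ord1 => ->.
Qed.

Lemma rational_card_row_supp n r (S : {set 'I_n * 'I_r}) z :
  rational_in_card (fun F => #|row_supp F S z|%:Z).
Proof.
have H (u : 'I_1 * 'I_r) : rational_in_card (fun F : finFieldType =>
    #|[pred x : F | ((z, u.2) \notin S) ==> (x == 0)]|%:Z).
  case: (_ \in S) => /=; first exact: rational_card.
  apply: rational_ext (rational_cst 1) => F.
  by rewrite -[1]/(1%N : int) -(card1 (0 : F)).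
apply: rational_ext (rational_prod (index_enum _) H) => F.
by rewrite (card_mx_entries (fun i j x => ((z, j) \notin S) ==> (x == 0)))
  (big_morph Posz PoszM (erefl 1)); apply: eq_bigr => -[i j].
Qed.

(* The vertex [z] is simplicial: when its diagonal entry is invertible, a
   congruence clears the rest of its row and only changes unconstrained
   entries. *)
Lemma card_split_pts_diag (F : finFieldType) n r (S : {set 'I_n * 'I_r})
    (Z : {set 'I_n}) z :
  z \notin Z ->
  #|split_pts F S Z set0| = (#|split_pts F S (z |: Z) set0| +
    #|row_supp F S z| * #|split_pts F (clear_row S z) Z set0|)%N.
Proof.
move=> zZ; set A := split_pts F S Z set0.
rewrite -(cardsID [set M | ulsubmx M z z == 0] A); congr (_ + _)%N.
  apply: eq_card => M; rewrite in_setI [M \in [set _ | _]]inE.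
  apply/andP/split_ptsP => [[/split_ptsP[uM sM H1 H2 H3] /eqP Mz]|[uM sM H1 H2 H3]].
    split=> // i j /orP[ij|]; first by apply: H1; rewrite ij.
    rewrite in_setU1 => /orP[/eqP->|iZ]; last by apply: H1; rewrite iZ orbT.
    by case: (eqVneq z j) => [<-//|zj]; apply: H1; rewrite zj.
  split; last by rewrite H1 // !inE !eqxx orbT.
  apply/split_ptsP; split=> // i j /orP[ij|iZ]; apply: H1; rewrite ?ij //.
  by rewrite in_setU1 iZ !orbT.
rewrite -cardsX.
(* Shearing by [- row_of M] clears row [z]. Shearing a cleared matrix by [x] puts [x] times the
   diagonal entry there, so [x] can be read off again: the pairs are in bijection with the
   matrices. *)
pose row_of (M : 'M[F]_(n + r)) := (ulsubmx M z z)^-1 *: row z (ursubmx M).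
have row_ofE M j : row_of M 0 j = (ulsubmx M z z)^-1 * ursubmx M z j.
  by rewrite mxE [X in _ * X]mxE.
apply: (@card_in_cancel _ _ _ _
  (fun M => (row_of M, shear_congr z (- row_of M) M))
  (fun u => shear_congr z u.1 u.2)).
- move=> M; rewrite in_setD inE => /andP[Mz /split_ptsP[uM sM H1 H2 _]].
  have dM i j : i != j -> ulsubmx M i j = 0 by move=> ij; apply: H1; rewrite ij.
  rewrite in_setX; apply/andP; split.
    by apply/row_suppP => j /H2 M0; rewrite row_ofE M0 mulr0.
  apply/split_ptsP; split; rewrite ?shear_congr_unit ?ulsubmx_shear_congr //.
  + exact: shear_congr_sym.
  + move=> i j; rewrite ursubmx_shear_congr // !inE negb_and negbK.
    case: (eqVneq i z) => [->|_]; last by rewrite orbF !mul0r addr0 => /H2.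
    by move=> _; rewrite mul1r [X in _ * X]mxE row_ofE mulrN mulVKf ?subrr.
  + by move=> i j; rewrite inE.
- case=> x M; rewrite in_setX => /andP[/row_suppP xS MS].
  have /split_ptsP[uM sM H1 H2 _] := MS.
  have dM i j : i != j -> ulsubmx M i j = 0 by move=> ij; apply: H1; rewrite ij.
  rewrite in_setD inE /= ulsubmx_shear_congr; rewrite (split_pts_diag_neq0 MS) /=.
  apply/split_ptsP; split; rewrite ?shear_congr_unit ?ulsubmx_shear_congr //.
  + exact: shear_congr_sym.
  + move=> i j ijS; rewrite ursubmx_shear_congr // H2 ?inE ?(negPf ijS) //.
    by case: eqP ijS => [->|_] ijS; rewrite ?mul0r ?addr0 // xS ?mulr0 ?addr0.
  + by move=> i j; rewrite inE.
- move=> M _ /=; rewrite -{1}[row_of M]opprK; exact: shear_congrK.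
- case=> x M; rewrite in_setX => /andP[/row_suppP xS MS].
  have /split_ptsP[uM sM H1 H2 _] := MS.
  have dM i j : i != j -> ulsubmx M i j = 0 by move=> ij; apply: H1; rewrite ij.
  have Mz := split_pts_diag_neq0 MS.
  have rx : row_of (shear_congr z x M) = x.
    apply/rowP => j; rewrite row_ofE ulsubmx_shear_congr ursubmx_shear_congr //.
    rewrite H2 ?inE ?eqxx ?andbF //.
    by rewrite add0r mul1r mulKf.
  by rewrite /= rx shear_congrK.
Qed.

(** * Inclusion-exclusion on the imposed entries *)

Lemma card_split_pts_entry (F : finFieldType) n r (S : {set 'I_n * 'I_r}) (Z : {set 'I_n})
    (N : {set 'I_n * 'I_r}) u :
  u \notin N ->
  #|split_pts F S Z N| = (#|split_pts F S Z (u |: N)| +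
    #|split_pts F (S :\ u) Z N|)%N.
Proof.
move=> uN; set A := split_pts F S Z N.
rewrite -(cardsID [set M | ursubmx M u.1 u.2 != 0] A); congr (_ + _)%N.
  apply: eq_card => M; rewrite in_setI [M \in [set _ | _]]inE.
  apply/andP/split_ptsP => [[/split_ptsP[uM sM H1 H2 H3] Mu]|[uM sM H1 H2 H3]].
    split=> // i j; rewrite in_setU1 => /orP[/eqP E|]; last exact: H3.
    by move: Mu; rewrite -E.
  split; last by apply: H3; rewrite -surjective_pairing setU11.
  by apply/split_ptsP; split=> // i j ijN; apply: H3; rewrite in_setU1 ijN orbT.
(* A matrix whose entry at [u] vanishes is a matrix for the graph without the edge [u]. *)
apply: eq_card => M; rewrite in_setD [M \in [set _ | _]]inE negbK.
apply/andP/split_ptsP => [[/eqP Mu /split_ptsP[uM sM H1 H2 H3]]|[uM sM H1 H2 H3]].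
  split=> // i j; rewrite in_setD1 negb_and negbK => /orP[/eqP E|]; last exact: H2.
  by move: Mu; rewrite -E.
split; first by rewrite H2 // -surjective_pairing setD11.
apply/split_ptsP; split=> // i j ijS; apply: H2.
by rewrite in_setD1 negb_and ijS orbT.
Qed.

(** The inner induction imposes the diagonal zeros while [N] is empty, because a shear does not
    preserve the nonvanishing of entries; the outer one then imposes [N]. Both recursions delete
    edges, so [S] varies throughout. *)
Lemma rational_split_pts n r (S : {set 'I_n * 'I_r}) (Z : {set 'I_n})
    (N : {set 'I_n * 'I_r}) :
  (forall T : {set 'I_n * 'I_r}, Zo_polynomial (split_graph T)) ->
  rational_in_card (fun F => #|split_pts F S Z N|%:Z).
Proof.
move=> poly.
elim: {N}#|N| {-2}N (erefl #|N|) S => [|k IH] N.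
  move/cards0_eq=> -> {N}.
  elim: {Z}#|Z| {-2}Z (erefl #|Z|) => [|k IH] Z.
    move/cards0_eq=> -> S; have [f fE] := poly S.
    by apply: rational_ext (rational_poly f) => F; rewrite -fE Zo_count_split.
  move=> cZ S; have /card_gt0P[z zZ] : (0 < #|Z|)%N by rewrite cZ.
  have cZz : #|Z :\ z| = k by move: cZ; rewrite (cardsD1 z) zZ => -[].
  apply: rational_ext (rationalB (IH _ cZz S)
    (rationalM (rational_card_row_supp S z) (IH _ cZz (clear_row S z)))) => F.
  have /(card_split_pts_diag F S) -> : z \notin Z :\ z by rewrite setD11.
  by rewrite setD1K // PoszD PoszM addrK.
move=> cN S; have /card_gt0P[u uN] : (0 < #|N|)%N by rewrite cN.
have cNu : #|N :\ u| = k by move: cN; rewrite (cardsD1 u) uN => -[].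
apply: rational_ext (rationalB (IH _ cNu S) (IH _ cNu (S :\ u))) => F.
have /(card_split_pts_entry F S Z) -> : u \notin N :\ u by rewrite setD11.
by rewrite setD1K // PoszD addrK.
Qed.

(** * Completions of a block and their dependence on its rank *)

(* The matrices [[0, Y, W], [Y^T, *, *], [W^T, *, *]] where the last condition
   says that [W] vanishes on its first [s] columns. *)
Definition completions (F : finFieldType) n s (Y : 'M[F]_n) :
    {set 'M[F]_(n + (n + n))} :=
  [set M | [&& M \in unitmx, M^T == M, ulsubmx M == 0,
    lsubmx (ursubmx M) == Y & rsubmx (ursubmx M) *m (pid_mx s : 'M_n) == 0]].

(** Congruence by the block diagonal matrix with blocks [g], [h^T] and 1 is injective; it sends [Y]
    to [g *m Y *m h] and [W] to [g *m W], whose zero columns persist. *)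
Lemma card_completions_le (F : finFieldType) n s (Y g h : 'M[F]_n) :
  g \in unitmx -> h \in unitmx ->
  (#|completions s Y| <= #|completions s (g *m Y *m h)|)%N.
Proof.
move=> ug uh; pose k : 'M[F]_(n + n) := block_mx h^T 0 0 1%:M.
pose K : 'M[F]_(n + (n + n)) := block_mx g 0 0 k.
have uK : K \in unitmx.
  by rewrite unitmxE !det_ublock det1 mulr1 unitrM -!unitmxE ug unitmx_tr.
pose f M := K *m M *m K^T.
have f_inj : injective f.
  apply: (can_inj (g := fun M => invmx K *m M *m invmx (K^T))) => M.
  by rewrite /f !mulmxA mulVmx // mul1mx -mulmxA mulmxV ?unitmx_tr // mulmx1.
rewrite -(card_imset _ f_inj); apply/subset_leq_card/subsetP => _ /imsetP[M + ->].
rewrite !inE => /and5P[uM /eqP sM /eqP M0 /eqP MY /eqP MW].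
have ulf : ulsubmx (f M) = 0.
  rewrite /f -[M]submxK M0 tr_block_mx !mulmx_block !trmx0 block_mxKul.
  by rewrite !mulmx0 !mul0mx !addr0 mul0mx.
have urf : ursubmx (f M) = row_mx (g *m Y *m h) (g *m rsubmx (ursubmx M)).
  rewrite /f -[M in LHS]submxK M0 tr_block_mx !mulmx_block !trmx0 block_mxKur.
  rewrite !mulmx0 !mul0mx !addr0 !add0r -[ursubmx M in LHS]hsubmxK MY.
  rewrite mul_mx_row tr_block_mx mul_row_block trmxK !trmx0 trmx1.
  by rewrite !mulmx0 addr0 add0r mulmx1.
rewrite !unitmx_mul unitmx_tr uK uM /= !trmx_mul trmxK sM mulmxA eqxx /=.
by rewrite -/(f M) ulf urf row_mxKl row_mxKr !eqxx -mulmxA MW mulmx0 eqxx.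
Qed.

Lemma card_completions_rank (F : finFieldType) n s (Y : 'M[F]_n) :
  #|completions s Y| = #|completions s (pid_mx (\rank Y) : 'M[F]_n)|.
Proof.
set L := col_ebase Y; set U := row_ebase Y; set P := pid_mx _.
have uL : L \in unitmx by apply: col_ebase_unit.
have uU : U \in unitmx by apply: row_ebase_unit.
have YE : L *m P *m U = Y by apply: mulmx_ebase.
have PE : invmx L *m Y *m invmx U = P.
  by rewrite -YE !mulmxA mulVmx // mul1mx -mulmxA mulmxV // mulmx1.
(* The rank normal form and [Y] are equivalent in both directions, which gives the two
   inequalities. *)
apply/eqP; rewrite eqn_leq -{1}PE -{3}YE.
by rewrite !card_completions_le // unitmx_inv.
Qed.

(** Invertibility with a zero upper left block forces [[Y, W]] to have rank [n], but [W] has at most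
    [n - s] nonzero columns, hence rank at most [n - s]. *)
Lemma completions_eq0 (F : finFieldType) n s (Y : 'M[F]_n) :
  (s <= n)%N -> (\rank Y < s)%N -> #|completions s Y| = 0%N.
Proof.
move=> sn Ys; apply/eqP; rewrite cards_eq0; apply/eqP/setP => M; rewrite !inE.
apply/negP => /and5P[uM _ /eqP M0 /eqP MY /eqP MW].
set W := rsubmx (ursubmx M) in MW.
have XE : ursubmx M = Y *m row_mx 1%:M 0 + W *m row_mx 0 1%:M.
  rewrite !mul_mx_row !mulmx1 !mulmx0 add_row_mx.
  by rewrite addr0 add0r -MY hsubmxK.
(* This is the upper left block of [M *m invmx M = 1]; the zero block of [M] leaves a right inverse
   of [[Y, W]]. *)
have XB : ursubmx M *m dlsubmx (invmx M) = 1%:M.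
  have := mulmxV uM; rewrite -[X in X *m _]submxK -[X in _ *m X]submxK.
  by rewrite mulmx_block scalar_mx_block M0 mul0mx add0r => /eq_block_mx[].
have : (n <= \rank (ursubmx M))%N.
  have := mxrankM_maxl (ursubmx M) (dlsubmx (invmx M)).
  by rewrite XB mxrank1.
apply/negP; rewrite -ltnNge XE.
have rW : (\rank W <= n - s)%N.
  have -> : W = W *m copid_mx s by rewrite mulmxBr mulmx1 MW subr0.
  by rewrite -(rank_copid_mx F sn) mxrankM_maxr.
apply: leq_ltn_trans (mxrank_add _ _) _.
apply: leq_ltn_trans (leq_add (mxrankM_maxl _ _) (mxrankM_maxl _ _)) _.
by apply: leq_ltn_trans (leq_add (leqnn _) rW) _; rewrite addnC -ltn_subRL subKn.
Qed.

Lemma completions_pid_neq0 (F : finFieldType) n s :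
  (s <= n)%N -> #|completions s (pid_mx s : 'M[F]_n)|%:Z != 0.
Proof.
move=> sn; suff: (0 < #|completions s (pid_mx s : 'M[F]_n)|)%N by case: #|_|.
apply/card_gt0P; pose X : 'M[F]_(n, n + n) := row_mx (pid_mx s) (copid_mx s).
have tX : X^T = col_mx (pid_mx s) (copid_mx s).
  by rewrite tr_row_mx linearB /= trmx1 !tr_pid_mx.
have XX : X *m X^T = 1%:M.
  by rewrite tX mul_row_col pid_mx_id // copid_mx_id // /copid_mx addrC subrK.
have XXX : X *m (X^T *m X) = X by rewrite mulmxA XX mul1mx.
(* As [X *m X^T = 1], the product [X^T *m X] is idempotent; filling the corner with the
   complementary idempotent makes [M] an involution. *)
pose M : 'M[F]_(n + (n + n)) := block_mx 0 X X^T (1%:M - X^T *m X).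
have MM : M *m M = 1%:M.
  rewrite mulmx_block !mul0mx !mulmx0 !add0r XX.
  rewrite mulmxBr mulmx1 XXX subrr mulmxBl mul1mx -mulmxA XX mulmx1 subrr.
  rewrite mulmxBr mulmx1 mulmxBl mul1mx -[X in _ - (_ - X)]mulmxA XXX subrr subr0.
  by rewrite addrC subrK -scalar_mx_block.
exists M; rewrite inE; apply/and5P; split.
- by case/mulmx1_unit: MM.
- by rewrite tr_block_mx trmx0 trmxK linearB /= trmx1 trmx_mul trmxK.
- by rewrite block_mxKul.
- by rewrite block_mxKur row_mxKl.
- by rewrite block_mxKur row_mxKr mul_copid_mx_pid.
Qed.

(** * Support patterns and the number of completions *)

Definition pattern_supp n (S : {set 'I_n * 'I_n}) : {set 'I_n * 'I_(n + n)} :=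
  [set u | if split u.2 is inl j then (u.1, j) \in S else false].

(** Allowed positions ([pattern_edges]) and required ones ([pattern_supp]) agree on [Y], which fixes
    its support; on [W] the columns from [s] on are allowed and nothing is required. *)
Definition pattern_edges n s (S : {set 'I_n * 'I_n}) : {set 'I_n * 'I_(n + n)} :=
  [set u | match split u.2 with inl j => (u.1, j) \in S | inr j => (s <= j)%N end].

Lemma mulmx_pid_eq0 (F : fieldType) n s (W : 'M[F]_n) :
  reflect (forall i (j : 'I_n), (j < s)%N -> W i j = 0) (W *m (pid_mx s : 'M_n) == 0).
Proof.
have E i j : (W *m (pid_mx s : 'M_n)) i j = W i j *+ (j < s)%N.
  rewrite mxE (bigD1 j) //= big1 => [|k kj]; rewrite !mxE ?eqxx /=.
    by rewrite addr0 mulr_natr.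
  by rewrite (inj_eq val_inj) (negPf kj) mulr0.
apply: (iffP eqP) => [/matrixP W0 i j js|W0].
  by have := W0 i j; rewrite E js mxE.
by apply/matrixP => i j; rewrite E mxE; case: ltnP => // /(W0 i)->.
Qed.

(** Taking [setT] for the vanishing diagonal entries kills the whole upper left block, so the points
    fibre over [Y]. *)
Lemma card_split_pts_pattern (F : finFieldType) n s (S : {set 'I_n * 'I_n}) :
  #|split_pts F (pattern_edges s S) setT (pattern_supp S)| =
  (\sum_(Y | exact_support S Y) #|completions s (Y : 'M[F]_n)|)%N.
Proof.
rewrite -sum1_card.
rewrite (partition_big (fun M => lsubmx (ursubmx M)) (@exact_support F n n S)) => [|M].
  apply: eq_bigr => Y /exact_supportP SY; rewrite -sum1_card; apply: eq_bigl => M.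
  rewrite [in RHS]inE; apply/andP/and5P.
    case=> /split_ptsP[uM sM H1 H2 H3] /eqP MY.
    split; rewrite ?sM ?MY //.
      by apply/eqP/matrixP => i j; rewrite H1 ?inE ?orbT // mxE.
    apply/mulmx_pid_eq0 => i j js.
    by rewrite mxE H2 // inE /= (unsplitK (inr _)) -ltnNge.
  case=> uM /eqP sM /eqP M0 /eqP MY /mulmx_pid_eq0 MW; split; last by rewrite MY.
  have ME i j : ursubmx M i (lshift n j) = Y i j by rewrite -MY [RHS]mxE.
  apply/split_ptsP; split=> // i j.
  - by rewrite M0 mxE.
  - rewrite inE /= -[j]splitK unsplitK; case: (split j) => k /=.
      by rewrite ME -SY negbK => /eqP.
    by rewrite -ltnNge => /(MW i); rewrite mxE.
  - rewrite inE /= -[j]splitK unsplitK; case: (split j) => k //=.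
    by rewrite ME SY.
case/split_ptsP=> uM sM H1 H2 H3; apply/exact_supportP => i j; rewrite mxE.
case: (boolP (_ \in S)) => ijS; first by rewrite H3 // inE /= (unsplitK (inl _)).
by rewrite H2 ?eqxx // inE /= (unsplitK (inl _)).
Qed.

Definition diag_supp n rho : {set 'I_n * 'I_n} :=
  [set u : 'I_n * 'I_n | (u.1 == u.2) && (u.1 < rho)%N].

Lemma rank_diag_supp (F : finFieldType) n rho (Y : 'M[F]_n) :
  (rho <= n)%N -> exact_support (diag_supp n rho) Y -> \rank Y = rho.
Proof.
move=> rn /exact_supportP SY.
(* The value 1 from index [rho] on only makes [diag_mx d] invertible; [pid_mx rho] erases it from
   the product. *)
pose d : 'rV[F]_n := \row_i (if (i < rho)%N then Y i i else 1).
have -> : Y = pid_mx rho *m diag_mx d.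
  apply/matrixP => i j; rewrite mul_mx_diag !mxE (inj_eq val_inj).
  have := SY i j; rewrite inE /=.
  case: (eqVneq i j) => [<-|_] /=; last by move/negbFE/eqP->; rewrite mul0r.
  by case: ltnP => _; [rewrite mul1r | move/negbFE/eqP->; rewrite mul0r].
rewrite mxrankMfree ?rank_pid_mx // row_free_unit unitmxE det_diag unitfE.
apply/prodf_neq0 => i _; rewrite mxE.
by case: ltnP => [ir|_]; rewrite ?oner_eq0 // SY inE /= eqxx.
Qed.

(** All matrices of support [diag_supp n rho] have rank [rho], so their pattern count is their
    number times the number of completions, and the first factor can be divided out. *)
Lemma rational_card_completions n s rho :
  (forall m (G : sgraph m), Zo_polynomial G) -> (rho <= n)%N ->
  rational_in_card (fun F => #|completions s (pid_mx rho : 'M[F]_n)|%:Z).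
Proof.
move=> poly rn.
apply: (rational_cancelM (psi := fun F =>
  #|[set Y : 'M[F]_n | exact_support (diag_supp n rho) Y]|%:Z)).
- by move=> F; apply: exact_support_card_neq0.
- exact: rational_card_exact_support.
refine (rational_ext _ (rational_split_pts (pattern_edges s (diag_supp n rho)) setT
  (pattern_supp (diag_supp n rho)) (fun T => poly _ (split_graph T)))) => F.
rewrite card_split_pts_pattern -PoszM mulnC -sum_nat_const; congr Posz.
apply: eq_big => [Y|Y SY]; first by rewrite inE.
by rewrite card_completions_rank (rank_diag_supp rn SY).
Qed.

(** * The triangular system for counts by rank *)

Definition rank_count (F : finFieldType) n (S : {set 'I_n * 'I_n}) rho :=
  #|[set Y : 'M[F]_n | exact_support S Y & \rank Y == rho]|.

Lemma card_split_pts_rank (F : finFieldType) n s (S : {set 'I_n * 'I_n}) :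
  #|split_pts F (pattern_edges s S) setT (pattern_supp S)| =
  (\sum_(rho < n.+1) rank_count F S rho * #|completions s (pid_mx rho : 'M[F]_n)|)%N.
Proof.
rewrite card_split_pts_pattern.
rewrite (partition_big (fun Y : 'M[F]_n => inord (\rank Y) : 'I_n.+1) xpredT) //=.
apply: eq_bigr => rho _; rewrite -sum_nat_const; apply: eq_big => [Y|Y].
  by rewrite inE -val_eqE /= inordK // ltnS rank_leq_row.
case/andP=> _ /eqP <-.
by rewrite card_completions_rank inordK // ltnS rank_leq_row.
Qed.

(** Descending induction on [s]: in the pattern count with parameter [s], ranks below [s] contribute
    nothing, ranks above are known, and the coefficient at rank [s] is nonzero. *)
Lemma rational_rank_count n (S : {set 'I_n * 'I_n}) s :
  (forall m (G : sgraph m), Zo_polynomial G) -> (s <= n)%N ->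
  rational_in_card (fun F => (rank_count F S s)%:Z).
Proof.
move=> poly; have [k] := ubnP (n - s)%N; elim: k s => // k IH s nsk sn.
apply: (rational_cancelM (psi := fun F =>
  #|completions s (pid_mx s : 'M[F]_n)|%:Z)).
- by move=> F; apply: completions_pid_neq0.
- exact: rational_card_completions.
have sn1 : (s < n.+1)%N by [].
have tail : rational_in_card (fun F => \sum_(rho < n.+1 | (s < rho)%N)
    (rank_count F S rho)%:Z * #|completions s (pid_mx rho : 'M[F]_n)|%:Z).
  apply: rational_sum => rho srho; have rn : (rho <= n)%N by rewrite -ltnS.
  by apply: rationalM; [apply: IH => //; lia | apply: rational_card_completions].
apply: rational_ext (rationalB (rational_split_pts (pattern_edges s S) setT
  (pattern_supp S) (fun T => poly _ (split_graph T))) tail) => F.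
rewrite card_split_pts_rank (big_morph Posz PoszD (erefl 0)).
rewrite (eq_bigr _ (fun rho _ => PoszM _ _)).
rewrite (bigID (fun rho : 'I_n.+1 => (s < rho)%N)) /= addrC.
rewrite addrK (bigD1 (Ordinal sn1)) /= ?ltnn // big1 ?addr0 ?PoszM // => rho.
rewrite -leqNgt -val_eqE /= => /andP[le ne].
by rewrite completions_eq0 ?mulr0 // rank_pid_mx //; lia.
Qed.

(** * Matrices supported on the complement of the Fano plane *)

(** These are the nonzero vectors over the field with two elements: 0, 1, 2 form a basis, 3, 4, 5
    are its sums in pairs and 6 is its total sum. *)
Definition fano_points : seq (seq bool) :=
  [:: [:: true; false; false]; [:: false; true; false]; [:: false; false; true];
      [:: true; true; false]; [:: true; false; true]; [:: false; true; true];
      [:: true; true; true]].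

Definition fano_coord (i : 'I_7) (k : 'I_3) : bool :=
  nth false (nth [::] fano_points i) k.

(** Lines are encoded by their normal vectors: an odd scalar product means that the point lies off
    the line. *)
Definition antifano : {set 'I_7 * 'I_7} :=
  [set u | odd (\sum_(k < 3) (fano_coord u.1 k && fano_coord u.2 k))].

(** Over ['F_2] the scalar products are themselves the entries, and a Gram matrix of vectors in
    dimension 3 has rank at most 3. *)
Lemma antifano_F2 : exists2 Y : 'M['F_2]_7, exact_support antifano Y & (\rank Y <= 3)%N.
Proof.
pose A : 'M['F_2]_(7, 3) := \matrix_(i, k) (fano_coord i k)%:R.
exists (A *m A^T); last exact: leq_trans (mxrankM_maxl _ _) (rank_leq_col _).
apply/forallP => i; apply/forallP => j; rewrite inE mxE /=.
set s := (\sum_(k < 3) _)%N.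
have -> : \sum_k A i k * A^T k j = s%:R.
  rewrite natr_sum; apply: eq_bigr => k _.
  by rewrite !mxE; case: fano_coord; case: fano_coord; rewrite ?mulr0 ?mul0r ?mulr1.
rewrite -[s in s%:R]odd_double_half natrD -mul2n natrM pchar_Zp // mul0r addr0.
by case: (odd s).
Qed.

(** Both [(x, y)] and [(u, v)] are orthogonal to the nonzero vector [(a, b)], so the first is a
    multiple of the second and inherits its orthogonality to [(c, d)]. *)
Lemma fano_relation (F : fieldType) (x y u v a b c d : F) :
  a != 0 -> b != 0 -> u != 0 -> x * a + y * b = 0 -> u * a + v * b = 0 ->
  u * c + v * d = 0 -> x * c + y * d = 0.
Proof.
move=> a0 b0 u0 H1 H2 H3.
have H : x * v = y * u.
  apply: (mulIf b0); apply: (mulIf a0).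
  have -> : x * v * b * a =
    (x * a + y * b) * (v * b) - y * b * (u * a + v * b) + y * u * b * a by ring.
  by rewrite H1 H2; ring.
apply: (mulIf u0).
have -> : (x * c + y * d) * u = x * (u * c + v * d) - (x * v - y * u) * d by ring.
by rewrite H3 H; ring.
Qed.

(* Rows 0, 1, 2 span the row space, with coefficients [K]. The terms [t k] of the
   expansion of the entry (6, 6) are pairwise opposite: for [t 0] and [t 1] this
   comes from the zero entries (6, 3), (3, 3) and (3, 6), where 3 is the third
   point of the line through 0 and 1. *)
Lemma antifano_rank (F : finFieldType) (Y : 'M[F]_7) :
  exact_support antifano Y -> (\rank Y <= 3)%N -> 2%:R = 0 :> F.
Proof.
pose o7 k : 'I_7 := inord k.
move=> /forallP supp rkY.
pose T i j := Y (o7 i) (o7 j).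
pose c i k := nth false (nth [::] fano_points i) k.
(* The parity defining [antifano], in a form that computes on numerals. *)
pose I i j := (c i 0 && c j 0) (+) (c i 1 && c j 1) (+) (c i 2 && c j 2).
have nz i j : (i < 7)%N -> (j < 7)%N -> (T i j != 0) = I i j.
  move=> i7 j7; have /forallP/(_ (o7 j))/eqP -> := supp (o7 i).
  rewrite inE !big_ord_recr big_ord0 /= /fano_coord /o7 /= !inordK //.
  by rewrite !oddD !oddb.
have T0 i j : (i < 7)%N -> (j < 7)%N -> ~~ I i j -> T i j = 0.
  by move=> i7 j7; rewrite -nz // negbK => /eqP.
pose f (i : 'I_3) : 'I_7 := o7 i.
pose R := rowsub f Y.
(* This principal block is diagonal with nonzero entries, so rows 0, 1, 2 are independent; rank at
   most 3 then makes them span. *)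
have RD : \det (mxsub f f Y) != 0.
  suff -> : mxsub f f Y = diag_mx (\row_i Y (f i) (f i)).
    rewrite det_diag; apply/prodf_neq0 => i _; rewrite mxE.
    by rewrite -/(T i i) nz; case: i => -[|[|[|]]].
  apply/matrixP => i j; rewrite !mxE; case: eqP => [->|]; first by rewrite mulr1n.
  move=> ne; rewrite mulr0n -/(T i j) T0; move: ne => //;
    case: i => -[|[|[|]]] //= i3; case: j => -[|[|[|]]] //= j3 ne;
    by case: ne; apply: val_inj.
have rkR : (3 <= \rank R)%N.
  have rk : \rank (mxsub f f Y) = 3%N by apply/mxrank_unit; rewrite unitmxE unitfE.
  apply: leq_trans (_ : 3 <= \rank (mxsub f f Y))%N _; first by rewrite rk.
  have -> : mxsub f f Y = R *m colsub f 1%:M.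
    by rewrite mulmx_colsub mulmx1; apply/matrixP => i j; rewrite !mxE.
  exact: mxrankM_maxl.
have RY : (R <= Y)%MS by apply: rowsub_sub.
have /submxP[C YC] : (Y <= R)%MS.
  by rewrite -(geq_leqif (mxrank_leqif_sup RY)) (leq_trans rkY).
pose K i (k : nat) := C (o7 i) (inord k).
have E i j : T i j = K i 0%N * T 0%N j + K i 1%N * T 1%N j + K i 2%N * T 2%N j.
  rewrite [in LHS]/T [in LHS]YC mxE !big_ord_recr big_ord0 /= add0r !mxE /K /T /f.
  by congr (C _ _ * Y (o7 _) _ + C _ _ * Y (o7 _) _ + C _ _ * Y (o7 _) _);
    apply: val_inj; rewrite /= ?inordK.
(* In the first three columns a single term of [E] survives, so [K] has the same support as [Y]
   there. *)
have KT i k : (i < 7)%N -> (k < 3)%N -> T i k = K i k * T k k.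
  move=> i7; case: k => [|[|[|]]] // _; rewrite E.
  - by rewrite (T0 1%N 0%N) ?(T0 2%N 0%N) ?mulr0 ?addr0.
  - by rewrite (T0 0%N 1%N) ?(T0 2%N 1%N) ?mulr0 ?addr0 ?add0r.
  - by rewrite (T0 0%N 2%N) ?(T0 1%N 2%N) ?mulr0 ?add0r.
have Keq0 i k : (i < 7)%N -> (k < 3)%N -> (K i k == 0) = ~~ I i k.
  move=> i7 k3; have k7 : (k < 7)%N by apply: ltn_trans k3 _.
  rewrite -nz // KT // mulf_eq0 -[T k k == 0]negbK nz //.
  by rewrite negbK; move: k3; case: k {k7} => [|[|[|]]]; rewrite // orbF.
have K0 i k : (i < 7)%N -> (k < 3)%N -> ~~ I i k -> K i k = 0.
  by move=> i7 k3 Iik; apply/eqP; rewrite Keq0.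
have Kn i k : (i < 7)%N -> (k < 3)%N -> I i k -> K i k != 0.
  by move=> i7 k3 Iik; rewrite Keq0 // negbK.
pose t k := K 6 k * T k 6.
have t01 : t 0%N + t 1%N = 0.
  apply: (@fano_relation _ _ _ (K 3%N 0%N) (K 3%N 1%N) (T 0%N 3%N) (T 1%N 3%N));
    rewrite ?nz ?Kn //.
  - by move: (E 6%N 3%N); rewrite (T0 6%N 3%N) // (T0 2%N 3%N) // mulr0 addr0.
  - by move: (E 3%N 3%N); rewrite (T0 3%N 3%N) // (T0 2%N 3%N) // mulr0 addr0.
  - by move: (E 3%N 6%N); rewrite (T0 3%N 6%N) // (K0 3%N 2%N) // mul0r addr0.
(* The role of 3 passes to 4, on the line through 0 and 2, and then to 5, on the line through 1 and
   2. *)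
have t02 : t 0%N + t 2%N = 0.
  apply: (@fano_relation _ _ _ (K 4%N 0%N) (K 4%N 2%N) (T 0%N 4%N) (T 2%N 4%N));
    rewrite ?nz ?Kn //.
  - by move: (E 6%N 4%N); rewrite (T0 6%N 4%N) // (T0 1%N 4%N) // mulr0 addr0.
  - by move: (E 4%N 4%N); rewrite (T0 4%N 4%N) // (T0 1%N 4%N) // mulr0 addr0.
  - by move: (E 4%N 6%N); rewrite (T0 4%N 6%N) // (K0 4%N 1%N) // mul0r addr0.
have t12 : t 1%N + t 2%N = 0.
  apply: (@fano_relation _ _ _ (K 5%N 1%N) (K 5%N 2%N) (T 1%N 5%N) (T 2%N 5%N));
    rewrite ?nz ?Kn //.
  - by move: (E 6%N 5%N); rewrite (T0 6%N 5%N) // (T0 0%N 5%N) // mulr0 add0r.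
  - by move: (E 5%N 5%N); rewrite (T0 5%N 5%N) // (T0 0%N 5%N) // mulr0 add0r.
  - by move: (E 5%N 6%N); rewrite (T0 5%N 6%N) // (K0 5%N 0%N) // mul0r add0r.
have t0n : t 0%N != 0 by rewrite mulf_neq0 ?nz ?Kn.
apply: (mulIf t0n); rewrite mul0r.
have -> : 2%:R * t 0%N = (t 0%N + t 1%N) + (t 0%N + t 2%N) - (t 1%N + t 2%N) by ring.
by rewrite t01 t02 t12 subr0 addr0.
Qed.

(** * Characteristic 2 against the odd primes *)

Theorem mainTheorem4 : exists (n : nat) (G : sgraph n), ~ Zo_polynomial G.
Proof.
apply: NNPP => noG.
have poly m (G : sgraph m) : Zo_polynomial G.
  by apply: NNPP => nG; apply: noG; exists m, G.
have [Y SY rkY] := antifano_F2.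
(* The rank counted is that of [Y] itself, whatever its value up to 3, so that [Y] makes the count
   nonzero over ['F_2]. *)
have /rational_eq0_odd_primes R0 :=
  rational_rank_count antifano poly (rank_leq_row Y).
suff /R0/(_ 'F_2) : forall p, prime p -> odd p ->
    (rank_count 'F_p antifano (\rank Y))%:Z = 0.
  by move=> -[] /eqP; rewrite cards_eq0 => /eqP/setP/(_ Y); rewrite !inE SY eqxx.
move=> p p_pr p_odd; congr Posz; apply/eqP; rewrite cards_eq0.
apply/eqP/setP => X; rewrite !inE; apply/negP => /andP[SX /eqP rkX].
have /eqP : 2%:R = 0 :> 'F_p by apply: antifano_rank SX _; rewrite rkX.
by rewrite -(dvdn_pcharf (pchar_Fp p_pr)) dvdn_prime2 // => /eqP p2; rewrite p2 in p_odd.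
Qed.
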